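(* Let $s\ge2$, let $\mathcal{P}=\prod_{i=1}^s\mathcal{E}_i$ with $|\mathcal{E}_i|=e_i>1$, let $v=|\mathcal{P}|=\prod_{i=1}^s e_i$, let $G=\mathrm{Sym}(\mathcal{E}_1)\times\cdots\times\mathrm{Sym}(\mathcal{E}_s)$ act coordinatewise on $\mathcal{P}$, and let $B\subseteq\mathcal{P}$ be nonempty with $|B|=k$. Let $D=\gcd(e_1-1,\dots,e_s-1)$, let $I=\{1,\dots,s\}$, and for each $J\subseteq I$ let $$y_J=1+\frac{k-1}{v-1}\left(\Bigl(\prod_{i\in I\setminus J}e_i\Bigr)-1\right)$$ (the empty product being $1$). If $\mathscr{D}(B,G)$ is a $2$-design on which $G$ acts flag-transitively, then: (i) $v-1$ divides $(k-1)\cdot D$, and the subset $B$ has uniform array $(y_J : J\subseteq I)$; and (ii) for each $\varnothing\ne J\subseteq I$, $y_J$ is a positive integer dividing $\frac{D_J}{D}\prod_{i\in I\setminus J}e_i$, where $D_J=\gcd(e_j-1 : j\in J)$. Moreover, for each $J\subseteq I$, each class $C\in\mathscr{C}_J$, and each block $B'$ of $\mathscr{D}(B,G)$, the intersection size $|B'\cap C|$ lies in $\{0,y_J\}$.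
   Context: All sets are finite. $G$ acts by $(\delta_1,\dots,\delta_s)^{(g_1,\dots,g_s)}=(\delta_1^{g_1},\dots,\delta_s^{g_s})$. $\mathscr{D}(B,G)$ is the incidence structure with point set $\mathcal{P}$ and block set $B^G=\{B^g : g\in G\}$; it is a $2$-design if every pair of distinct points lies in the same number of blocks. A flag is an incident point-block pair, and $G$ is flag-transitive if it is transitive on flags. For $J\subseteq I$ let $\mathcal{E}_J=\prod_{i\in J}\mathcal{E}_i$ (a singleton if $J=\varnothing$), let $\pi_J:\mathcal{P}\to\mathcal{E}_J$ be the natural projection, and for $\delta_J\in\mathcal{E}_J$ let $C_{\delta_J}=\{\varepsilon\in\mathcal{P} : \varepsilon\pi_J=\delta_J\}$; let $\mathscr{C}_J=\{C_{\delta_J} : \delta_J\in\mathcal{E}_J\}$, a partition of $\mathcal{P}$. A subset $B$ has uniform array $(y_J : J\subseteq I)$ if the $y_J$ are positive integers with $y_I=1$ and, for each $J\subsetneq I$ and each $\delta_J\in\mathcal{E}_J$, $|B\cap C_{\delta_J}|\in\{0,y_J\}$. *)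

(* Defs.v *)
From HB Require Import structures.
From mathcomp Require Import all_boot all_order all_fingroup all_algebra.

Set Implicit Arguments.
Unset Strict Implicit.
Unset Printing Implicit Defensive.

Import Order.TTheory GRing.Theory Num.Theory.

Section Designs.

(* An incidence structure whose blocks are sets of points, with incidence
   given by membership. *)
Variables (aT : finGroupType) (P : finType).
Implicit Types (blocks : {set {set P}}) (x y : P) (b c : {set P}).

(* The block set of D(B, G): a set of subsets, so no repeated blocks. *)
Definition orbit_blocks (to : {action aT &-> P}) (G : {set aT}) (B : {set P}) :
    {set {set P}} :=
  orbit to^* G B.

Definition is_2design blocks : Prop :=
  exists lambda : nat, forall x y, x != y ->
    #|[set b in blocks | x \in b & y \in b]| = lambda.

Definition is_flag blocks x b : Prop := b \in blocks /\ x \in b.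

Definition flag_transitive (to : {action aT &-> P}) (G : {set aT}) blocks :
    Prop :=
  forall x b y c, is_flag blocks x b -> is_flag blocks y c ->
    exists2 g, g \in G & to x g = y /\ to^*%act b g = c.

End Designs.

Section CartesianProduct.

Variables (I : finType) (E : I -> finType).

Definition points := {dffun forall i, E i}.

(* The group law is the coordinatewise one of [gproduct]. *)
Definition sym_prod := {dffun forall i, {perm E i}}.

Definition coord_act (x : points) (g : sym_prod) : points :=
  [ffun i => g i (x i)].

Lemma coord_act1 : coord_act^~ 1%g =1 id.
Proof. by move=> x; apply/ffunP=> i; rewrite !ffunE perm1. Qed.

Lemma coord_actM x : act_morph coord_act x.
Proof. by move=> g h; apply/ffunP=> i; rewrite !ffunE permM. Qed.

Canonical coord_action := TotalAction coord_act1 coord_actM.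

(* E_J is the product over the subtype of indices lying in J; it has exactly
   one element when J is empty. *)
Definition partial_points (J : {set I}) :=
  {dffun forall i : {i : I | i \in J}, E (val i)}.

Definition proj (J : {set I}) (x : points) : partial_points J :=
  [ffun i => x (val i)].

Definition coord_class (J : {set I}) (d : partial_points J) : {set points} :=
  [set x | proj J x == d].

Definition coord_classes (J : {set I}) : {set {set points}} :=
  [set coord_class d | d : partial_points J].

(* The array is rational-valued because the arrays of interest are given by
   quotients; that its entries are positive integers is part of the
   definition. *)
Definition uniform_array (B : {set points}) (y : {set I} -> rat) : Prop :=
  [/\ forall J : {set I}, (y J \is a Num.nat) && (0 < y J)%R,
      y [set: I] = 1%R
    & forall (J : {set I}) (d : partial_points J), J \proper [set: I] ->
        #|B :&: coord_class d|%:R%R \in [:: 0%R; y J]].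

Definition gcd_pred (J : {set I}) : nat :=
  \big[gcdn/0%N]_(j in J) #|E j|.-1.

(* Hence the natural-number quotient of D_J by D_I is exact. *)
Lemma gcd_predT_dvd (J : {set I}) : gcd_pred [set: I] %| gcd_pred J.
Proof.
apply: (big_ind (fun m => gcd_pred [set: I] %| m)) => [|m n dm dn|j _].
- exact: dvdn0.
- by rewrite dvdn_gcd dm dn.
- by rewrite /gcd_pred (bigD1 j) ?inE //= dvdn_gcdl.
Qed.

Definition design_array (B : {set points}) (J : {set I}) : rat :=
  (1 + (#|B|%:R - 1) / ((\prod_i #|E i|)%N%:R - 1)
       * ((\prod_(i in ~: J) #|E i|)%N%:R - 1))%R.

End CartesianProduct.

(* Main.v *)
Require Import Defs.
From mathcomp Require Import all_boot all_order all_fingroup all_algebra.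

Set Implicit Arguments.
Unset Strict Implicit.
Unset Printing Implicit Defensive.

Import GRing.Theory Num.Theory.

(** By flag-transitivity all nonempty intersections of a block with a class of
    C_J have one common size z_J.  Counting, for a fixed point x of B, the pairs
    (y, b) with y <> x in the class of x and b a block through x and y gives
    lambda * (|C| - 1) = r * (z_J - 1), and comparing with J = set0 yields
    z_J = y_J.  Taking J to be the complement of {i} shows that v - 1 divides
    (k - 1)(e_i - 1), so that m = (k - 1) D / (v - 1) is an integer.  Finally, for
    j in J the number z_J divides z_(J - j), hence also the difference
    (m / D) * |C| * (e_j - 1), while z_J = 1 + m * ((|C| - 1) / D) is coprime
    to m. *)

Lemma dvdn_mul_biggcd (I : finType) (A : {set I}) (F : I -> nat) (d c : nat) :
    (forall i, i \in A -> d %| c * F i) ->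
  d %| c * \big[gcdn/0]_(i in A) F i.
Proof.
move=> dF; apply: (big_ind (fun m => d %| c * m)) => //.
  by rewrite muln0 dvdn0.
by move=> a b da db; rewrite muln_gcdr dvdn_gcd da.
Qed.

(** Induction on [#|A|]: removing the whole fiber of one [x] leaves the fibers of the other points
    intact, so the hypothesis survives. *)
Lemma dvdn_card_fibers (T : finType) (U : eqType) (f : T -> U) (A : {set T})
    (z : nat) :
    (forall x, x \in A -> #|[set u in A | f u == f x]| = z) ->
  z %| #|A|.
Proof.
move=> fib; elim: {A}_.+1 {-2}A (ltnSn #|A|) fib => // n IHn A ltAn fib.
have [->|[x xA]] := set_0Vmem A; first by rewrite cards0 dvdn0.
rewrite -(cardsID [set u in A | f u == f x]).
have -> : A :&: [set u in A | f u == f x] = [set u in A | f u == f x].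
  by apply/setIidPr/subsetP => u; rewrite inE => /andP[].
rewrite (fib x xA) dvdn_addr //; apply: IHn => [|u].
  apply: leq_trans (_ : #|A| <= n) => //; apply: proper_card.
  by apply/properP; split; [exact: subsetDl | exists x; rewrite // !inE xA eqxx].
rewrite !inE => /andP[fu uA]; rewrite -(fib u uA); apply: eq_card => t.
rewrite !inE; move: fu; rewrite uA /=; case: (t \in A); rewrite ?andbF //= andbT.
by have [-> /negPf -> |] := eqVneq (f t) (f u); rewrite ?andbF ?andbT.
Qed.

Lemma design_count (P : finType) (blocks : {set {set P}}) (lambda t : nat)
    (x : P) (S : {set P}) :
    (forall y z, y != z ->
       #|[set b in blocks | y \in b & z \in b]| = lambda) ->
    x \in S ->
    (forall b, b \in blocks -> x \in b -> #|b :&: S| = t) ->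
  lambda * #|S|.-1 = #|[set b in blocks | x \in b]| * t.-1.
Proof.
move=> des xS hS.
have -> : #|S|.-1 = #|S :\ x| by rewrite [in LHS](cardsD1 x) xS.
rewrite mulnC -!sum_nat_const.
(* Double count of the incidences between points of [S :\ x] and blocks through [x]; the right-hand
   side appears once the sums are exchanged. *)
transitivity (\sum_(y in S :\ x) \sum_(b in blocks | x \in b) (y \in b : nat)).
  apply: eq_bigr => y; rewrite !inE => /andP[yx _].
  rewrite -(des x y) 1?eq_sym // -sum1dep_card [RHS]big_mkcond /=.
  by rewrite big_mkcond; apply: eq_bigr => b _; do !case: (_ \in _).
rewrite exchange_big /= [RHS](eq_bigl (fun b => (b \in blocks) && (x \in b))).
  apply: eq_bigr => b /andP[bB xb].
  rewrite -(hS b bB xb) [in RHS](cardsD1 x) !inE xb xS /= -sum1_card.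
  rewrite big_mkcond [RHS]big_mkcond; apply: eq_bigr => y _; rewrite !inE.
  by do !case: (y \in _); case: (y == x).
by move=> b; rewrite inE.
Qed.

Section CoordinateClasses.

Variables (I : finType) (E : I -> finType).
Implicit Types (J K : {set I}) (x u : points E) (B : {set points E}).

Lemma eq_projP J x u :
  reflect (forall i, i \in J -> x i = u i) (proj J x == proj J u).
Proof.
apply: (iffP eqP) => [xu i iJ | xu].
  by have /ffunP/(_ (exist _ i iJ)) := xu; rewrite !ffunE.
by apply/ffunP => -[i iJ]; rewrite !ffunE /=; exact: xu.
Qed.

Lemma mem_coord_class J x : x \in coord_class (proj J x).
Proof. by rewrite inE. Qed.

Lemma coord_class0 x : coord_class (proj set0 x) = [set: points E].
Proof. by apply/setP => u; rewrite !inE; apply/eq_projP => i; rewrite inE. Qed.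

Lemma card_coord_class J x :
  #|coord_class (proj J x)| = \prod_(i in ~: J) #|E i|.
Proof.
(* The class is a box: coordinates in [J] are pinned to those of [x], the others are free. *)
pose F i : pred (E i) := fun a => (i \in J) ==> (a == x i).
have -> : #|coord_class (proj J x)| = #|(family F : pred (points E))|.
  apply: eq_card => u; rewrite inE; apply/eq_projP/familyP => ux i.
    by apply/implyP => iJ; rewrite ux.
  by move=> iJ; have /implyP/(_ iJ)/eqP := ux i.
rewrite card_family foldrE big_image /= [RHS]big_mkcond; apply: eq_bigr => i _.
rewrite inE; case: (boolP (i \in J)) => iJ /=.
  by rewrite -(card1 (x i)); apply: eq_card => a; rewrite unfold_in /F iJ.
by apply: eq_card => a; rewrite unfold_in /F (negPf iJ).
Qed.

Lemma proj_coord_act J x u (g : sym_prod E) :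
  (proj J (coord_act x g) == proj J (coord_act u g)) = (proj J x == proj J u).
Proof.
apply/eq_projP/eq_projP => xu i iJ.
  by have := xu i iJ; rewrite !ffunE; exact: perm_inj.
by rewrite !ffunE xu.
Qed.

Section FlagTransitive.

Variables (G : {set sym_prod E}) (blocks : {set {set points E}}).
Hypothesis flagG : flag_transitive (coord_action E) G blocks.

(** An element carrying one flag to the other also carries the class of [x] onto that of [u], since
    the coordinatewise action preserves agreement on [J]. *)
Lemma card_flag_class J b c x u :
    is_flag blocks x b -> is_flag blocks u c ->
  #|b :&: coord_class (proj J x)| = #|c :&: coord_class (proj J u)|.
Proof.
move=> xb uc; have [g _ [<- <-]] := flagG xb uc.
rewrite -[LHS](card_imset _ (act_inj (coord_action E) g)); apply: eq_card => w.
rewrite inE; apply/imsetP/andP => [[t] | []].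
  rewrite !inE => /andP[tb tx] ->; split; last by rewrite proj_coord_act.
  exact: imset_f.
by case/imsetP=> t tb ->; rewrite inE proj_coord_act => tx; exists t; rewrite ?inE ?tb.
Qed.

(** The [J]-classes refine the [K]-class of [x]; those that meet [b] do so at flags, hence all in
    the same number of points. *)
Lemma dvdn_card_flag_class J K b x :
    K \subset J -> is_flag blocks x b ->
  #|b :&: coord_class (proj J x)| %| #|b :&: coord_class (proj K x)|.
Proof.
move=> KJ xb; apply: (dvdn_card_fibers (f := proj J)) => u; rewrite !inE.
case/andP=> ub /eq_projP ux.
have bu : is_flag blocks u b by case: xb.
rewrite (card_flag_class J xb bu); apply: eq_card => t; rewrite !inE.
case: (t \in b) => //=.
have [/eq_projP tu|_] := boolP (proj J t == proj J u); last first.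
  by rewrite andbF.
by rewrite andbT; apply/eq_projP => i iK; rewrite tu ?ux ?(subsetP KJ).
Qed.

(* [z_J - 1 = (k - 1) (|C| - 1) / (v - 1)], cleared of denominators. *)
Lemma card_flag_class_eq J b x :
    is_2design blocks -> is_flag blocks x b ->
  #|b :&: coord_class (proj J x)|.-1 * (\prod_i #|E i|).-1
    = #|b|.-1 * (\prod_(i in ~: J) #|E i|).-1.
Proof.
move=> [lambda des] xb.
have count K : lambda * (\prod_(i in ~: K) #|E i|).-1 =
    #|[set c in blocks | x \in c]| * #|b :&: coord_class (proj K x)|.-1.
  rewrite -(card_coord_class K x).
  apply: (design_count des (mem_coord_class K x)) => c cB xc.
  exact: card_flag_class.
have r_gt0 : 0 < #|[set c in blocks | x \in c]|.
  by apply/card_gt0P; exists b; case: xb => bB xb; rewrite inE bB.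
(* For [set0] the class is the whole point set, so the count relates [v - 1] to [k - 1]. *)
have := count set0; rewrite coord_class0 setIT setC0.
have -> : \prod_(i in [set: I]) #|E i| = \prod_i #|E i|.
  by apply: eq_bigl => i; rewrite inE.
move=> count0; apply/eqP; rewrite -(eqn_pmul2l r_gt0) !mulnA -count -count0.
by rewrite mulnAC.
Qed.

End FlagTransitive.

(** Each [#|E i|] is 1 modulo [D], hence so is any product of them. *)
Lemma gcd_pred_prod J :
    (forall i, 0 < #|E i|) ->
  gcd_pred E [set: I] %| (\prod_(i in J) #|E i|).-1.
Proof.
move=> E_gt0; set D := gcd_pred E _.
rewrite -subn1 -eqn_mod_dvd; last by rewrite prodn_gt0.
apply/eqP; apply: (big_ind (fun m => m = 1 %[mod D])) => // [a b a1 b1|i _].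
  by rewrite -modnMml a1 modnMml mul1n.
apply/eqP; rewrite eqn_mod_dvd // subn1.
by rewrite /D /gcd_pred (bigD1 i) ?inE //= dvdn_gcdl.
Qed.

End CoordinateClasses.

(** Here [V], [K] and [w] stand for [v - 1], [k - 1] and the class size. Cancelling [D] leaves [z]
    dividing [m * w * (DJ %/ D)], and coprimality removes [m]. *)
Lemma dvdn_array_entry (D DJ K V w z m : nat) :
    0 < D -> 0 < V -> 0 < z -> D %| DJ -> D %| w.-1 ->
    m * V = K * D -> z.-1 * V = K * w.-1 -> z * D %| m * w * DJ ->
  z %| DJ %/ D * w.
Proof.
move=> D_gt0 V_gt0 z_gt0 /dvdnP[c ->] /dvdnP[q wq] mV zV.
have z1 : z.-1 = m * q.
  apply/eqP; rewrite -(eqn_pmul2r V_gt0) zV wq mulnAC mV.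
  by rewrite mulnA mulnAC.
have czm : coprime z m.
  by rewrite -(prednK z_gt0) z1 /coprime -addn1 mulnC gcdnC gcdnMDl gcdn1.
rewrite mulnK // mulnA dvdn_pmul2r // -mulnA Gauss_dvdr // mulnC //.
Qed.

Theorem proposition6p2 (s : nat) (hs : 2 <= s) (E : 'I_s -> finType)
    (hE : forall i, 1 < #|E i|)
    (B : {set points E}) (hB : B != set0)
    (G := [set: sym_prod E])
    (blocks := orbit_blocks (coord_action E) G B)
    (v := \prod_i #|E i|) (k := #|B|)
    (D := gcd_pred E [set: 'I_s])
    (y := design_array B)
    (h2 : is_2design blocks)
    (hflag : flag_transitive (coord_action E) G blocks) :
  [/\ v.-1 %| k.-1 * D /\ uniform_array B y,
      forall J : {set 'I_s}, J != set0 ->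
        exists m : nat,
          [/\ y J = m%:R%R, 0 < m
            & m %| gcd_pred E J %/ D * \prod_(i in ~: J) #|E i|]
    & forall (J : {set 'I_s}) (C B' : {set points E}),
        C \in coord_classes E J -> B' \in blocks ->
        #|B' :&: C|%:R%R \in [:: 0%R; y J]].
Proof.
have [x xB] := set0Pn _ hB.
have Bb : B \in blocks by exact: orbit_refl.
have xBf : is_flag blocks x B by [].
have E_gt0 i : 0 < #|E i| by exact: ltnW.
pose w (J : {set 'I_s}) := \prod_(i in ~: J) #|E i|.
pose z (J : {set 'I_s}) := #|B :&: coord_class (proj J x)|.
have w_gt0 J : 0 < w J by rewrite prodn_gt0.
have z_gt0 J : 0 < z J.
  by apply/card_gt0P; exists x; rewrite inE xB mem_coord_class.
have k_gt0 : 0 < k by rewrite card_gt0.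
have i0 : 'I_s by exact: Ordinal (ltnW hs).
have wD1 (J : {set 'I_s}) j : j \in J -> w (J :\ j) = #|E j| * w J.
  move=> jJ; rewrite /w (bigD1 j) /= ?inE ?eqxx //; congr (_ * _).
  by apply: eq_bigl => i; rewrite !inE negb_and negbK; have [->|] := eqVneq i j;
    rewrite ?jJ ?andbF ?andbT.
have V_gt0 : 0 < v.-1.
  rewrite -subn1 subn_gt0 /v (bigD1 i0) //=.
  by rewrite (leq_trans (hE i0)) // leq_pmulr // prodn_gt0.
have D_gt0 : 0 < D.
  rewrite /D /gcd_pred (bigD1 i0) ?inE //= gcdn_gt0.
  by rewrite -subn1 subn_gt0 hE.
have zV J : (z J).-1 * v.-1 = k.-1 * (w J).-1.
  exact: (card_flag_class_eq hflag).
have yz J : y J = (z J)%:R%R.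
  have predR n : 0 < n -> (n.-1%:R = n%:R - 1 :> rat)%R.
    by move=> n_gt0; rewrite -subn1 natrB.
  have v_neq0 : (v%:R - 1 != 0 :> rat)%R.
    by rewrite -predR ?pnatr_eq0 -?lt0n // prodn_gt0.
  have /(congr1 (fun n => n%:R%R : rat)) := zV J.
  rewrite !natrM !predR // ?prodn_gt0 // => zVR.
  rewrite /y /design_array -/k -/v -/(w J) mulrAC -zVR mulfK //.
  by rewrite addrC subrK.
have inter J (d : partial_points E J) b : b \in blocks ->
    (#|b :&: coord_class d|%:R \in [:: 0; y J])%R.
  (* A nonempty intersection contains some [u]; the flag formed by [u] and [b] is then compared with
     that of [x] and [B]. *)
  move=> bB; have [->|[u]] := set_0Vmem (b :&: coord_class d).
    by rewrite cards0 inE eqxx.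
  rewrite inE inE => /andP[ub /eqP <-].
  have ubf : is_flag blocks u b by [].
  by rewrite (card_flag_class hflag J ubf xBf) !inE yz eqxx orbT.
have VD : v.-1 %| k.-1 * D.
  (* A class for the complement of [i] has [#|E i|] points, so [zV] gives the quotient
     explicitly. *)
  apply: dvdn_mul_biggcd => i _; apply/dvdnP; exists (z (~: [set i])).-1.
  by rewrite zV /w setCK big_set1.
split; last by move=> J C B' /imsetP[d _ ->]; exact: inter.
  split=> //; split=> [J||J d _]; last exact: inter.
    by rewrite yz natr_nat ltr0n z_gt0.
  by rewrite /y /design_array setCT big_set0 subrr mulr0 addr0.
move=> J _; exists (z J); split=> //.
have [m mV] := dvdnP VD.
apply: (@dvdn_array_entry D _ k.-1 v.-1 _ _ m) => //.
- exact: gcd_predT_dvd.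
- exact: gcd_pred_prod.
apply: dvdn_mul_biggcd => j jJ.
(* The two decrements cancel, leaving a difference of two multiples of [z J]. *)
have zJj : z J %| (z (J :\ j)).-1 - (z J).-1.
  have le1 n : 0 < n -> n.-1 = n - 1 by rewrite subn1.
  rewrite !le1 // subnBA // subnK //.
  by rewrite dvdn_sub // (dvdn_card_flag_class hflag) // subsetDl.
suff -> : m * w J * #|E j|.-1 = ((z (J :\ j)).-1 - (z J).-1) * D.
  exact: dvdn_mul.
(* After multiplication by [v - 1], [zV] turns the difference of the [z] into [k - 1] times
   [w (J :\ j) - w J], which is [w J * (#|E j| - 1)]. *)
apply/eqP; rewrite -(eqn_pmul2r V_gt0); apply/eqP.
rewrite [RHS]mulnAC mulnBl !zV -mulnBr wD1 //.
have -> : (#|E j| * w J).-1 - (w J).-1 = w J * #|E j|.-1.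
  rewrite -[X in _ - X]subn1 -subn1 subnBA // subnK ?muln_gt0 ?E_gt0 ?w_gt0 //.
  by rewrite mulnC -[X in _ - X]muln1 -mulnBr subn1.
by rewrite [RHS]mulnAC mV [RHS]mulnAC mulnA.
Qed.
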